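(* Let $n\ge1$, and let $$A=\begin{pmatrix}0&1&1\\0&0&1\\1&0&1\end{pmatrix}$$ over $\mathbb F_2$. Consider the $2^n\times2^n\times2^n$ block of copies of $A$ with cyclic (triply periodic) boundary conditions, all permitted spin configurations being equally probable. Let $k\in\{1,2,3\}$ and take any $k$ different spins lying on edges parallel to the first coordinate axis that all intersect one fixed plane perpendicular to that axis. Then the probability that all $k$ spins take the value $0\in\mathbb F_2$ is $\frac1{2^k}$; in particular, any two, and any three, such spins are independent.
   Context: Vertices are $v=(v_1,v_2,v_3)\in(\mathbb Z/2^n)^3$ (cyclic boundary conditions: each output edge is identified with the input edge on the same line parallel to a coordinate axis). For each vertex $v$ and each direction $i\in\{1,2,3\}$ there is a spin $s_i(v)\in\mathbb F_2$ on the edge parallel to the $i$-th axis entering $v$. With $\epsilon_i$ the $i$-th unit vector, a spin configuration is permitted if at every vertex $$\begin{pmatrix}s_1(v+\epsilon_1)& s_2(v+\epsilon_2)& s_3(v+\epsilon_3)\end{pmatrix}=\begin{pmatrix}s_1(v)& s_2(v)& s_3(v)\end{pmatrix}A .$$ The probability measure is uniform on the (finite, nonempty) set of permitted configurations. The spins under consideration are the $s_1(v)$ with $v_1=c$ for a fixed $c$. *)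

(* Defs.v *)
From mathcomp Require Import all_boot all_order all_algebra.

Set Implicit Arguments.
Unset Strict Implicit.
Unset Printing Implicit Defensive.

Import Order.TTheory GRing.Theory Num.Theory.
Local Open Scope ring_scope.

(* 'Z_(2 ^ n) is the ring of integers modulo 2 ^ n only when 0 < n. *)
Definition vertex (n : nat) := 'rV['Z_(2 ^ n)]_3.

(* s v 0 i is the spin on the edge parallel to axis i entering v.  The edge
   leaving v along axis i is the one entering v + delta_mx 0 i, so each edge is
   represented exactly once, and the identification of opposite faces is the
   arithmetic modulo 2 ^ n. *)
Definition config (n : nat) := {ffun vertex n -> 'rV['F_2]_3}.

Definition spin (n : nat) (i : 'I_3) (v : vertex n) (s : config n) : 'F_2 :=
  s v 0 i.

Definition is_permitted (A : 'M['F_2]_3) (n : nat) (s : config n) : bool :=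
  [forall v : vertex n,
     (\row_i spin i (v + delta_mx 0 i) s) == (\row_i spin i v s) *m A].

Definition permitted (A : 'M['F_2]_3) (n : nat) : {set config n} :=
  [set s | is_permitted A s].

(* Uniform probability on the permitted configurations; the denominator is
   nonzero by permitted_gt0 below. *)
Definition Pr (A : 'M['F_2]_3) (n : nat) (E : pred (config n)) : rat :=
  #|[set s in permitted A n | E s]|%:R / #|permitted A n|%:R.

(* Subfamilies are covered by taking B i = setT for the other indices. *)
Definition mutually_independent (A : 'M['F_2]_3) (n k : nat)
    (X : 'I_k -> config n -> 'F_2) : Prop :=
  forall B : 'I_k -> {set 'F_2},
    Pr A (fun s => [forall i, X i s \in B i]) =
    \prod_(i < k) Pr A (fun s => X i s \in B i).

Definition A0 : 'M['F_2]_3 :=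
  \matrix_(i < 3, j < 3)
    (nth [::] ([:: [:: 0; 1; 1];
         [:: 0; 0; 1];
         [:: 1; 0; 1]] : seq (seq 'F_2)) i)`_j.

Lemma permitted_gt0 (A : 'M['F_2]_3) (n : nat) : (0 < #|permitted A n|)%N.
Proof.
apply/card_gt0P; exists [ffun=> 0]; rewrite inE; apply/forallP => v.
have z (w : 'I_3 -> vertex n) :
    \row_i spin i (w i) ([ffun=> 0] : config n) = 0 :> 'rV['F_2]_3.
  by apply/rowP => i; rewrite !mxE /spin ffunE mxE.
by rewrite (z (fun i => v + delta_mx 0 i)) (z (fun=> v)) mul0mx.
Qed.

(* Main.v *)
Require Import Defs.
From mathcomp Require Import all_boot all_order all_algebra.
From mathcomp Require Import ring.

(** A permitted configuration is determined by its first spins [f], subject to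
    the single relation [f(v - e2) = f(v) + f(v + e1) + f(v + e1 + e3)].  So the
    values of [f] on one layer [v_2 = const] are free, and the other layers are
    obtained by iterating [T = 1 + x + x z], where [x], [z] are the shifts along
    axes 1 and 3; cyclicity along axis 2 is automatic because
    [T ^ (2 ^ n) = 1 + x ^ (2 ^ n) + (x z) ^ (2 ^ n) = 1] in characteristic 2.
    Starting from a delta function, one separates any two points of a plane
    [v_1 = const].  As the configuration with all spins 1 is permitted too,
    any 3 points of the plane are linearly independent on the space of permitted
    configurations, and the uniform measure then projects to the uniform measure
    on their spins. *)

Set Implicit Arguments.
Unset Strict Implicit.
Unset Printing Implicit Defensive.

Import GRing.Theory Num.Theory.
Local Open Scope ring_scope.

Lemma F2_addrr (x : 'F_2) : x + x = 0.
Proof. by rewrite (addrr_pchar2 (pchar_Fp (isT : prime 2))). Qed.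

Lemma F2_cases (x : 'F_2) : x = 0 \/ x = 1.
Proof. by case: x => [[|[|]]] // i; [left|right]; apply: val_inj. Qed.

(** * Iteration of the layer map over a commutative ring *)

Section LayerStep.
Variable R : finComNzRingType.
Implicit Types (g : {ffun R * R -> 'F_2}) (m c d : R).

Definition layer_step m g : {ffun R * R -> 'F_2} :=
  [ffun p => g p + g (p.1 + m, p.2) + g (p.1 + m, p.2 + m)].

(* The squaring map is additive in characteristic 2. *)
Lemma layer_step_double m g :
  layer_step m (layer_step m g) = layer_step (m + m) g.
Proof.
apply/ffunP => -[i j]; rewrite !ffunE /= !addrA.
set a := g (i + m, j); set b := g (i + m, j + m); set e := g (i + m + m, j + m).
transitivity (g (i, j) + (a + a) + (b + b) + (e + e) + g (i + m + m, j)
   + g (i + m + m, j + m + m)); first by ring.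
by rewrite !F2_addrr !addr0.
Qed.

Lemma iter_layer_step_exp2 r g :
  iter (2 ^ r) (layer_step 1) g = layer_step (2 ^ r)%:R g.
Proof.
elim: r g => [|r IH] g //.
by rewrite expnS mul2n -addnn iterD !IH layer_step_double natrD.
Qed.

Definition delta_fun (q : R * R) : {ffun R * R -> 'F_2} :=
  [ffun p => (p == q)%:R].

(* [iter b (layer_step 1) g p] sums [g] over the ends of the [b]-step paths from
   [p] with steps (0,0), (1,0), (1,1).  When both displacements are at least [b],
   only the diagonal path can reach the support of the delta function. *)
Lemma iter_layer_step_delta (a b i j : nat) c d :
    {in [pred k | (k <= a)%N] &, injective (fun k : nat => k%:R : R)} ->
    (i + b <= a)%N -> (j + b <= a)%N ->
  iter b (layer_step 1) (delta_fun (c + a%:R, d + a%:R)) (c + i%:R, d + j%:R)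
    = ((i + b == a)%N && (j + b == a)%N)%:R.
Proof.
move=> inj; elim: b i j => [|b IH] i j.
  rewrite !addn0 => ia ja; rewrite /= ffunE xpair_eqE.
  rewrite !(inj_eq (addrI _)).
  by rewrite (inj_in_eq inj ia (leqnn a)) (inj_in_eq inj ja (leqnn a)).
rewrite !addnS => ia ja; rewrite iterS ffunE /= -!addrA !natr1.
rewrite IH ?(ltnW ia) ?(ltnW ja) // IH ?addSn ?(ltnW ja) // IH ?addSn //.
by rewrite (ltn_eqF ia) (ltn_eqF ja) !andbF !mulr0n !add0r.
Qed.

End LayerStep.

(** * Configurations on the torus and separation of two points *)

Section Torus.
Variables (n : nat) (n_gt0 : (0 < n)%N).
Local Notation Zn := 'Z_(2 ^ n).

Let exp2n_gt1 : (1 < 2 ^ n)%N.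
Proof. by rewrite -{1}(expn0 2) ltn_exp2l. Qed.

Lemma exp2n_eq0 : (2 ^ n)%:R = 0 :> Zn.
Proof. by rewrite pchar_Zp. Qed.

(** Makes an element of [Zn] usable as an iteration count. *)
Lemma iter_layer_step_modn (k : nat) (g : {ffun Zn * Zn -> 'F_2}) :
  iter (k %% 2 ^ n) (layer_step 1) g = iter k (layer_step 1) g.
Proof.
have per h : iter (2 ^ n) (layer_step 1) h = h :> {ffun Zn * Zn -> 'F_2}.
  (* With step 0 the three terms coincide, and [h + h + h = h] in characteristic 2. *)
  rewrite iter_layer_step_exp2 exp2n_eq0; apply/ffunP => -[i j].
  by rewrite !ffunE /= !addr0 -addrA F2_addrr addr0.
rewrite [in RHS](divn_eq k (2 ^ n)) addnC iterD.
by congr iter; elim: (_ %/ _)%N => // m IH; rewrite mulSn iterD -IH per.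
Qed.

(** The content is the wrap-around [t + 1 = 0], where periodicity closes the recursion around axis
    2. *)
Lemma iter_layer_stepS (t : Zn) (g : {ffun Zn * Zn -> 'F_2}) :
  iter (t + 1)%R (layer_step 1) g
    = layer_step 1 (iter t (layer_step 1) g).
Proof.
rewrite -iterS -[in RHS]iter_layer_step_modn; congr iter.
by rewrite -(val_Zp_nat exp2n_gt1) -natr1 natr_Zp.
Qed.

(** The representative of [a] is below [2 ^ n], so no cast of a [k <= a] wraps around. *)
Lemma natr_Zn_inj (a : Zn) :
  {in [pred k | (k <= a)%N] &, injective (fun k : nat => k%:R : Zn)}.
Proof.
have lt k : (k <= a)%N -> (k < 2 ^ n)%N.
  by move=> /leq_ltn_trans; apply; rewrite -[X in (_ < X)%N](Zp_cast exp2n_gt1).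
move=> i j; rewrite !inE => /lt li /lt lj /(congr1 (@nat_of_ord _)).
by rewrite !val_Zp_nat // !modn_small.
Qed.

Let ax0 : 'I_3 := 0.
Let ax1 : 'I_3 := 1.
Let ax2 : 'I_3 := 2%:R.

Lemma is_permittedA0P (s : config n) :
  reflect (forall v, [/\ spin ax0 (v + delta_mx 0 ax0) s = spin ax2 v s,
                         spin ax1 (v + delta_mx 0 ax1) s = spin ax0 v s &
                         spin ax2 (v + delta_mx 0 ax2) s
                           = spin ax0 v s + spin ax1 v s + spin ax2 v s])
          (is_permitted A0 s).
Proof.
have rowE v (w : 'rV_3) : (w = (\row_i spin i v s) *m A0) <->
   [/\ w 0 ax0 = spin ax2 v s, w 0 ax1 = spin ax0 v s &
     w 0 ax2 = spin ax0 v s + spin ax1 v s + spin ax2 v s].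
  have mE j : ((\row_i spin i v s) *m A0) 0 j =
     spin ax0 v s * A0 ax0 j + spin ax1 v s * A0 ax1 j + spin ax2 v s * A0 ax2 j.
    rewrite mxE !big_ord_recl big_ord0 addr0 !mxE addrA.
    have -> : lift ord0 ord0 = ax1 by apply: val_inj.
    by have -> : lift ord0 (lift ord0 ord0) = ax2 :> 'I_3 by apply: val_inj.
  split=> [->|[w0 w1 w2]]; rewrite ?mE.
    by rewrite !mxE /= !mulr0 !mulr1 !add0r !addr0.
  apply/rowP => j; rewrite mE.
  case: j => [[|[|[|]]]] // jP.
  - by rewrite (_ : Ordinal jP = ax0) ?w0 ?mxE /= ?mulr0 ?mulr1 ?add0r ?addr0 //;
      apply: val_inj.
  - by rewrite (_ : Ordinal jP = ax1) ?w1 ?mxE /= ?mulr0 ?mulr1 ?add0r ?addr0 //;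
      apply: val_inj.
  - by rewrite (_ : Ordinal jP = ax2) ?w2 ?mxE /= ?mulr0 ?mulr1 ?add0r ?addr0 //;
      apply: val_inj.
apply: (iffP forallP) => P v; move: (P v).
  by move/eqP/rowE; rewrite !mxE.
by move=> Q; apply/eqP/rowE; rewrite !mxE.
Qed.

(** The first two columns of [A0] force the third spin at [v] to be [f (v + e1)] and the second to
    be [f (v - e2)]; the third column then becomes the relation assumed on [f]. *)
Lemma is_permitted_of_first_spin (f : vertex n -> 'F_2) :
    (forall v, f (v - delta_mx 0 ax1)
       = f v + f (v + delta_mx 0 ax0)
         + f (v + delta_mx 0 ax0 + delta_mx 0 ax2)) ->
  exists2 s : config n, is_permitted A0 s & forall v, spin 0 v s = f v.
Proof.
move=> fE.
exists [ffun v => \row_i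
   if i == ax0 then f v
   else if i == ax1 then f (v - delta_mx 0 ax1) else f (v + delta_mx 0 ax0)];
  last by move=> v; rewrite /spin ffunE mxE.
apply/is_permittedA0P => v; rewrite /spin !ffunE !mxE /=; split=> //.
  by rewrite addrK.
have cancel (a b e : 'F_2) : a + (a + b + e) + b = e.
  by transitivity ((a + a) + (b + b) + e); [ring | rewrite !F2_addrr !add0r].
rewrite fE cancel.
by congr f; rewrite addrAC.
Qed.

Lemma separating_config (x y : vertex n) :
    x 0 0 = y 0 0 -> x != y ->
  exists2 s : config n, is_permitted A0 s & spin 0 x s = 1 /\ spin 0 y s = 0.
Proof.
move=> xy0 xDy; set a : Zn := y 0 ax1 - x 0 ax1.
set c := x 0 ax0; set d := x 0 ax2.
(* The delta function lives in the layer of [y], [a] steps from that of [x], at the end of the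
   diagonal path from [x]; hence the value 1 at [x]. *)
pose g := delta_fun (c + (a : nat)%:R, d + (a : nat)%:R).
pose f (v : vertex n) : 'F_2 :=
  iter (y 0 ax1 - v 0 ax1)%R (layer_step 1) g (v 0 ax0, v 0 ax2).
have [v|s sP sE] := @is_permitted_of_first_spin f.
  have axE : ((ax0 == ax1) = false) * ((ax0 == ax2) = false) *
    ((ax1 == ax0) = false) * ((ax1 == ax2) = false) *
    ((ax2 == ax0) = false) * ((ax2 == ax1) = false) by [].
  rewrite /f !mxE !eqxx !axE !andbF !andbT !mulr0n !mulr1n !subr0 !addr0.
  by rewrite opprB addrA addrAC iter_layer_stepS ffunE.
exists s => //; rewrite !sE /f; split.
  rewrite -/a -/c -/d.
  have := @iter_layer_step_delta _ a a 0 0 c d (@natr_Zn_inj a).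
  by rewrite !addr0 !add0n !eqxx => ->.
(* No step is made at [y], whose first coordinate is [c]: it meets the support only if [a = 0] and
   the third coordinates agree, that is, if [x = y]. *)
rewrite subrr /= ffunE xpair_eqE.
have -> : y 0 ax0 = c by rewrite /c xy0.
rewrite natr_Zp -{1}[c]addr0 (inj_eq (addrI _)) eq_sym subr_eq0.
case: eqP => //= y1x1; rewrite /a y1x1 subrr addr0; case: eqP => // y2x2.
case/eqP: xDy; apply/rowP => -[[|[|[|]]]] // jP.
- by rewrite (_ : Ordinal jP = 0) //; apply: val_inj.
- by rewrite (_ : Ordinal jP = ax1) //; apply: val_inj.
- by rewrite (_ : Ordinal jP = ax2) //; apply: val_inj.
Qed.

End Torus.

(** * Additive structure of the permitted configurations *)

Section PermittedGroup.
Variables (A : 'M['F_2]_3) (n : nat).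
Implicit Types s t : config n.

Lemma spinD (i : 'I_3) (v : vertex n) s t :
  spin i v (s + t) = spin i v s + spin i v t.
Proof. by rewrite /spin ffunE mxE. Qed.

Lemma spin0 (i : 'I_3) (v : vertex n) : spin i v (0 : config n) = 0.
Proof. by rewrite /spin ffunE mxE. Qed.

Lemma is_permitted0 : is_permitted A (0 : config n).
Proof.
apply/forallP => v; apply/eqP.
have z (w : 'I_3 -> vertex n) :
    \row_i spin i (w i) (0 : config n) = 0 :> 'rV['F_2]_3.
  by apply/rowP => i; rewrite !mxE spin0.
by rewrite (z (fun i => v + delta_mx 0 i)) (z (fun=> v)) mul0mx.
Qed.

Lemma is_permittedD s t :
  is_permitted A s -> is_permitted A t -> is_permitted A (s + t).
Proof.
move=> /forallP sP /forallP tP; apply/forallP => v.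
have z (w : 'I_3 -> vertex n) : \row_i spin i (w i) (s + t) =
    \row_i spin i (w i) s + \row_i spin i (w i) t.
  by apply/rowP => i; rewrite !mxE spinD.
rewrite (z (fun i => v + delta_mx 0 i)) (z (fun=> v)) mulmxDl.
by rewrite (eqP (sP v)) (eqP (tP v)).
Qed.

Lemma config_addrr s : s + s = 0.
Proof. by apply/ffunP => v; apply/rowP => i; rewrite !ffunE !mxE F2_addrr. Qed.

End PermittedGroup.

Lemma is_permitted_ones n : exists2 s : config n,
  is_permitted A0 s & forall v, spin 0 v s = 1.
Proof.
apply: (@is_permitted_of_first_spin _ (fun=> 1)) => _.
by rewrite F2_addrr add0r.
Qed.

Lemma isolating_config n (x : vertex n) (l : seq (vertex n)) :
    (0 < n)%N -> (size l <= 2)%N -> x \notin l ->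
    {in l, forall y : vertex n, x 0 0 = y 0 0} ->
  exists2 s : config n, is_permitted A0 s &
    spin 0 x s = 1 /\ {in l, forall y : vertex n, spin 0 y s = 0}.
Proof.
move=> n_gt0; have [u uP uE] := is_permitted_ones n.
case: l => [|a [|b []]] // _.
- by move=> _ _; exists u.
- rewrite inE => xa /(_ a (mem_head _ _)) xa0.
  have [s sP [sx sa]] := separating_config n_gt0 xa0 xa.
  by exists s => //; split=> // y; rewrite inE => /eqP ->.
rewrite !inE negb_or => /andP[xa xb] x0.
have xa0 : x 0 0 = a 0 0 by apply: x0; rewrite !inE eqxx.
have xb0 : x 0 0 = b 0 0 by apply: x0; rewrite !inE eqxx orbT.
have [s sP [sx sa]] := separating_config n_gt0 xa0 xa.
have [t tP [tx tb]] := separating_config n_gt0 xb0 xb.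
have [sb|sb] := F2_cases (spin 0 b s).
  by exists s => //; split=> // y; rewrite !inE => /orP[] /eqP ->.
have [ta|ta] := F2_cases (spin 0 a t).
  by exists t => //; split=> // y; rewrite !inE => /orP[] /eqP ->.
(* Here s and t are the indicators of {x, b} and {x, a} on {x, a, b}. *)
exists (s + t + u); first by rewrite !is_permittedD.
split=> [|y]; first by rewrite !spinD sx tx uE F2_addrr add0r.
rewrite !inE => /orP[] /eqP ->.
  by rewrite !spinD sa ta uE add0r F2_addrr.
by rewrite !spinD sb tb uE addr0 F2_addrr.
Qed.

(** * Joint distribution of at most three spins of a plane *)

Section PlaneSpins.
Variables (n k : nat) (v : 'I_k -> vertex n).
Hypotheses (n_gt0 : (0 < n)%N) (k_le3 : (k <= 3)%N) (v_inj : injective v).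
Hypothesis v_plane : forall i j, v i 0 0 = v j 0 0.

Lemma plane_spins_surj (t : {ffun 'I_k -> 'F_2}) :
  exists2 s : config n, is_permitted A0 s & forall j, spin 0 (v j) s = t j.
Proof.
have isol (j : 'I_k) : exists s : config n,
    is_permitted A0 s && [forall i, spin 0 (v i) s == (i == j)%:R].
  have [||||s sP [sj si]] :=
      @isolating_config n (v j) [seq v i | i <- enum (predC1 j)].
  - by [].
  (* The bound [k <= 3] leaves at most two points besides [v j]. *)
  - rewrite size_map -cardE; have := cardC1 j; rewrite card_ord => ->.
    by case: (k) k_le3.
  - by rewrite mem_map // mem_enum !inE eqxx.
  - by move=> y /mapP[i _ ->].
  exists s; rewrite sP; apply/forallP => i; have [->|ij] := eqVneq i j.
    by rewrite sj.
  by rewrite si //; apply: map_f; rewrite mem_enum inE.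
(* The [e j] are dual to the points [v j]; summing them over the support of [t] realizes [t]. *)
pose e j := xchoose (isol j).
have eP j : is_permitted A0 (e j) by case/andP: (xchooseP (isol j)).
have eE j i : spin 0 (v i) (e j) = (i == j)%:R.
  by case/andP: (xchooseP (isol j)) => _ /forallP/(_ i)/eqP.
exists (\sum_(j | t j != 0) e j).
  elim/big_ind: _ => //; first exact: is_permitted0.
  exact: is_permittedD.
move=> i; rewrite (big_morph _ (spinD 0 (v i)) (spin0 0 (v i))).
have [ti|ti] := F2_cases (t i).
  rewrite ti big1 // => j tj; rewrite eE; case: eqP => // ij.
  by rewrite -ij ti in tj.
rewrite (bigD1 i) ?ti //= eE eqxx big1 ?addr0 // => j /andP[_ ji].
by rewrite eE eq_sym (negbTE ji).
Qed.

Let X (s : config n) : {ffun 'I_k -> 'F_2} := [ffun j => spin 0 (v j) s].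

(** Translation by a permitted configuration with spins [t] is an involution exchanging the fibers
    over [t] and 0. *)
Lemma card_plane_fiber (t : {ffun 'I_k -> 'F_2}) :
  #|[set s in permitted A0 n | X s == t]| =
  #|[set s in permitted A0 n | X s == 0]|.
Proof.
have [u uP uE] := plane_spins_surj t.
have XD s : X (s + u) = X s + t.
  by apply/ffunP => j; rewrite !ffunE spinD uE.
have uK : involutive (fun s : config n => s + u).
  by move=> s; rewrite -addrA config_addrr addr0.
rewrite -(card_imset _ (inv_inj uK)); apply: eq_card => s.
rewrite -{1}(uK s) (mem_imset _ _ (inv_inj uK)) !inE.
congr (_ && _); last by rewrite XD -{2}[t]add0r (inj_eq (addIr _)).
apply/idP/idP => [|sP]; last exact: is_permittedD.
by move=> /is_permittedD/(_ uP); rewrite uK.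
Qed.

Lemma card_plane_spins (T : {set {ffun 'I_k -> 'F_2}}) :
  #|[set s in permitted A0 n | X s \in T]| =
  (#|T| * #|[set s in permitted A0 n | X s == 0%R]|)%N.
Proof.
rewrite -sum1dep_card (partition_big X (mem T)) /=; last by move=> s /andP[].
rewrite -sum_nat_const; apply: eq_bigr => t tT.
rewrite -(card_plane_fiber t) -sum1dep_card; apply: eq_bigl => s.
by rewrite -andbA; congr (_ && _); case: eqP => [->|]; rewrite ?andbF ?andbT.
Qed.

Lemma Pr_plane_spins (B : 'I_k -> {set 'F_2}) :
  Pr A0 (fun s : config n => [forall j, spin 0 (v j) s \in B j])
    = \prod_(j < k) (#|B j|%:R / 2).
Proof.
have XB : [set s in permitted A0 n | [forall j, spin 0 (v j) s \in B j]] =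
    [set s in permitted A0 n | X s \in [set t in family B]].
  apply/setP => s; rewrite !inE; congr (_ && _).
  by apply/eq_forallb => j; rewrite ffunE.
have XT : permitted A0 n = [set s in permitted A0 n | X s \in [set: _]].
  by apply/setP => s; rewrite !inE andbT.
(* Numerator and denominator both become multiples of the common fiber size [K], which cancels. *)
rewrite /Pr XB [in X in _ / X]XT !card_plane_spins cardsT card_ffun card_Fp // card_ord.
rewrite cardsE card_family.
set K := #|_|; have K0 : K%:R != 0 :> rat.
  rewrite pnatr_eq0 -lt0n; apply/card_gt0P; exists 0.
  by rewrite !inE is_permitted0; apply/eqP/ffunP => j; rewrite !ffunE spin0.
rewrite !natrM invfM mulrA -[LHS]mulrA mulrACA divff // mulr1.
rewrite prodf_div prodr_const card_ord natrX; congr (_ / _).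
by rewrite foldrE big_image natr_prod.
Qed.

End PlaneSpins.

Theorem mainTheorem3 (n : nat) (hn : (1 <= n)%N)
    (k : nat) (hk : (1 <= k <= 3)%N)
    (c : 'Z_(2 ^ n)) (v : 'I_k -> vertex n) (v_inj : injective v)
    (v_plane : forall j : 'I_k, v j 0 0 = c) :
  Pr A0 (fun s : config n => [forall j : 'I_k, spin 0 (v j) s == 0])
    = 1 / 2 ^+ k
  /\ ((2 <= k)%N ->
      mutually_independent A0 (fun (j : 'I_k) (s : config n) => spin 0 (v j) s)).
Proof.
have PrE (E F : pred (config n)) : E =1 F -> Pr A0 E = Pr A0 F.
  by move=> EF; congr (_%:R / _); apply: eq_card => s; rewrite !inE EF.
have k_le3 : (k <= 3)%N by case/andP: hk.
have vv i j : v i 0 0 = v j 0 0 by rewrite !v_plane.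
have PrB := Pr_plane_spins hn k_le3 v_inj vv.
split=> [|_ B].
  rewrite (PrE _ (fun s => [forall j, spin 0 (v j) s \in [set 0]])); last first.
    by move=> s; apply: eq_forallb => j; rewrite inE.
  rewrite (PrB (fun=> [set 0])) prodr_const card_ord cards1 expr_div_n.
  by rewrite expr1n.
rewrite PrB; apply: eq_bigr => i _.
(* Each marginal is the same formula for the one-vertex family [v i]. *)
have inj1 : injective (fun _ : 'I_1 => v i) by move=> a b _; rewrite !ord1.
have := Pr_plane_spins hn (isT : (1 <= 3)%N) inj1 (fun _ _ => erefl) (fun=> B i).
rewrite big_ord1 => <-; apply: PrE => s.
by apply/forallP/idP => [/(_ 0)|? ?].
Qed.
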